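(* Let $n \ge 2$ and let $m \le n-2$ be a nonnegative integer. Let $S$ be a subgraph of $K_n$ isomorphic to a star with $m$ edges (i.e. $m$ edges sharing a common center vertex), and let $G$ be the graph on the same $n$ vertices obtained from $K_n$ by deleting the edges of $S$. Then $G$ has a path decomposition consisting of at most $\left\lfloor \frac{n+1}{2} \right\rfloor$ paths.
   Context: A path decomposition of a graph $G$ is a collection of paths (subgraphs of $G$) such that every edge of $G$ belongs to exactly one path in the collection. *)

(* Defs.v *)
From mathcomp Require Import all_boot.

Set Implicit Arguments.
Unset Strict Implicit.
Unset Printing Implicit Defensive.

Section Graphs.
Variable T : finType.

Definition simple_graph (e : rel T) : Prop := symmetric e /\ irreflexive e.

Definition complete_graph : rel T := [rel x y | x != y].

Definition delete_edges (e s : rel T) : rel T := [rel x y | e x y && ~~ s x y].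

Definition edges (e : rel T) : {set {set T}} :=
  [set [set u.1; u.2] | u : T * T & e u.1 u.2].

(* A star is represented by its edges only; in particular the star with no edge
   is the empty relation, with an arbitrary centre. *)
Definition star (m : nat) (s : rel T) : Prop :=
  [/\ simple_graph s,
      #|edges s| = m
    & exists c : T, forall x y, s x y -> x = c \/ y = c].

(* A path is given by the nonempty list of its vertices in order; a list and its
   reversal denote the same subgraph, and a single vertex is a path of length 0. *)
Definition is_path (e : rel T) (p : seq T) : bool :=
  if p is x :: q then path e x q && uniq p else false.

Definition path_edges (p : seq T) : seq {set T} :=
  if p is x :: q then pairmap (fun a b => [set a; b]) x q else [::].

Definition path_decomposition (e : rel T) (ps : seq (seq T)) : Prop :=
  all (is_path e) ps /\
  forall E : {set T}, E \in edges e ->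
    count (fun p => E \in path_edges p) ps = 1.

End Graphs.

Arguments complete_graph T : clear implicits.

(* Main.v *)
(* Label the vertices 0..N with N = n - 1 the centre c of the star, so that c is
   joined exactly to 0..k-1, with k = N - m > 0. With r = N/2, Walecki's zigzags
   P_i = (i, i+1, i-1, ..., i+r), i < r, decompose the complete graph on Z/2r.
   If N = 2r, then c can be attached to the end i of P_i; where it is also needed
   at the other end i+r, the resulting cycle is opened at {i, i+1}, and the
   deleted edges form one additional path 0, 1, 2, ... .
   If N = 2r+1, then a further vertex oo = 2r closes each P_i to a cycle. Delete
   {i, i+1} from all of these cycles, and also {i+r, i+r+1} from the first d of
   them: the deleted edges form the path 0, 1, ..., r+d. Then c can be attached
   once to a cycle opened once, and twice, in its interior, to a cycle cut into
   two arcs, which it joins; it is attached to the additional path at 0.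
   Finally, in the case m = 0 with n even, the zigzags themselves suffice. *)
Require Import Defs.
From mathcomp Require Import all_boot zify.

Set Implicit Arguments.
Unset Strict Implicit.
Unset Printing Implicit Defensive.

(** * Edges and paths on natural numbers *)

(** Sorting the two ends gives each undirected edge a single representative, so that edge sets can
    be compared as lists of pairs. *)
Definition edge (x y : nat) : nat * nat := (minn x y, maxn x y).

Definition path_pairs (p : seq nat) : seq (nat * nat) :=
  if p is x :: q then pairmap edge x q else [::].

Definition system_pairs (ps : seq (seq nat)) : seq (nat * nat) :=
  flatten [seq path_pairs p | p <- ps].

(** Adjacency is left out here: it follows later, once the pairs of the whole system are known to be
    those of [target]. *)
Definition nat_path (n : nat) (p : seq nat) : bool :=
  [&& p != [::], uniq p & all (gtn n) p].

(* The graph: c = N is joined to 0, ..., k-1, and all vertices below N to each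
   other. An edge is the pair of its ends in increasing order. *)
Definition target (N k : nat) : seq (nat * nat) :=
  [seq (x, y) | y <- iota 0 N, x <- iota 0 y] ++ [seq (x, N) | x <- iota 0 k].

Lemma edgeC x y : edge x y = edge y x.
Proof. by rewrite /edge minnC maxnC. Qed.

Lemma edge_lt x y : x < y -> edge x y = (x, y).
Proof. by move=> lt_xy; rewrite /edge; congr pair; lia. Qed.

Lemma path_pairs_cat p x q :
  path_pairs (p ++ x :: q) = path_pairs (rcons p x) ++ path_pairs (x :: q).
Proof.
case: p => [|y p] //=; rewrite -cat_rcons pairmap_cat last_rcons.
by case: q.
Qed.

Lemma path_pairs_rcons2 p x y :
  path_pairs (rcons (rcons p x) y) = rcons (path_pairs (rcons p x)) (edge x y).
Proof. by rewrite -[rcons _ y]cats1 cat_rcons path_pairs_cat cats1. Qed.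

Lemma path_pairs_mkseq f n :
  path_pairs (mkseq f n.+1) = mkseq (fun t => edge (f t) (f t.+1)) n.
Proof.
elim: n => [|n IHn] //.
rewrite [mkseq f n.+2]mkseqS [mkseq f n.+1]mkseqS path_pairs_rcons2 -mkseqS IHn.
by rewrite -mkseqS.
Qed.

Lemma size_path_pairs p : size (path_pairs p) = (size p).-1.
Proof. by case: p => //= x q; rewrite size_pairmap. Qed.

(** Only the vertices matter, not their order. The modified zigzags below rearrange a zigzag with
    one or two vertices added, so this makes them paths at once. *)
Lemma nat_path_perm n p q : perm_eq p q -> nat_path n q -> nat_path n p.
Proof.
move=> pq /and3P[q0 uq aq]; rewrite /nat_path (perm_uniq pq) uq (perm_all _ pq) aq.
by rewrite -size_eq0 (perm_size pq) size_eq0 q0.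
Qed.

Lemma nat_path_cons n x p :
  nat_path x p -> x < n -> nat_path n (x :: p).
Proof.
move=> /and3P[_ up ap] lt_xn; rewrite /nat_path /= up lt_xn /= andbT.
apply/andP; split; first by apply/negP => /(allP ap) /=; rewrite ltnn.
by apply/allP => y /(allP ap) /= lt_yx; apply: ltn_trans lt_xn.
Qed.

Lemma mem_target N k x y : k <= N ->
  ((x, y) \in target N k) = (x < y) && ((y < N) || (y == N) && (x < k)).
Proof.
move=> le_kN; rewrite mem_cat; apply/orP/idP.
  case=> [/allpairsPdep[y' [x' []]]|/mapP[x']]; rewrite !mem_iota.
    by rewrite !add0n !leq0n /= => lt_yN lt_xy [-> ->]; rewrite lt_xy lt_yN.
  by rewrite add0n => lt_xk [-> ->]; rewrite eqxx lt_xk orbT (leq_trans lt_xk).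
move=> /andP[lt_xy /orP[lt_yN|/andP[/eqP-> lt_xk]]]; [left|right].
  by apply/allpairsPdep; exists y, x; rewrite !mem_iota; split=> //; lia.
by apply/mapP; exists x => //; rewrite mem_iota.
Qed.

Lemma uniq_target N k : uniq (target N k).
Proof.
rewrite cat_uniq; apply/and3P; split.
- apply: allpairs_uniq_dep => [|y _|]; rewrite ?iota_uniq //.
  by move=> [y x] [y' x'] _ _ /= [-> ->].
- apply/hasPn => _ /mapP[x _ ->]; apply/negP => /allpairsPdep[y' [x' []]].
  by rewrite !mem_iota => ? ? [_]; lia.
- by rewrite map_inj_uniq ?iota_uniq // => x y [].
Qed.

(** Doubling avoids dividing N(N-1) by 2. *)
Lemma size_target N k : (size (target N k)).*2 = N * N.-1 + k.*2.
Proof.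
rewrite size_cat size_map size_iota size_allpairs_dep doubleD; congr (_ + _).
have ->: [seq size (iota 0 y) | y <- iota 0 N] = iota 0 N.
  by rewrite -[RHS]map_id; apply: eq_map => y; rewrite size_iota.
elim: N => // N IHN; rewrite -addn1 iotaD sumn_cat doubleD IHN /= addn0.
by case: N {IHN} => [|N] /=; nia.
Qed.

(* As many pairs as the target, all of it covered: nothing is covered twice. *)
Lemma perm_target N k ps :
  {subset target N k <= system_pairs ps} ->
  size (system_pairs ps) <= size (target N k) ->
  perm_eq (system_pairs ps) (target N k).
Proof.
move=> sub le_size; rewrite perm_sym uniq_perm ?uniq_target //.
  exact: leq_size_uniq (uniq_target N k) sub le_size.
by have [_] := uniq_min_size (uniq_target N k) sub le_size.
Qed.

Lemma system_pairs_cons p ps :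
  system_pairs (p :: ps) = path_pairs p ++ system_pairs ps.
Proof. by []. Qed.

Lemma system_pairs_cat ps qs :
  system_pairs (ps ++ qs) = system_pairs ps ++ system_pairs qs.
Proof. by rewrite /system_pairs map_cat flatten_cat. Qed.

Lemma size_system_pairs_const (I : Type) (F : I -> seq nat) (s : seq I) l :
  (forall i, size (F i) = l.+1) ->
  size (system_pairs [seq F i | i <- s]) = size s * l.
Proof.
move=> sizeF; elim: s => //= i s IHs.
by rewrite /system_pairs /= size_cat size_path_pairs sizeF -/(system_pairs _) IHs.
Qed.

Lemma mem_system_pairs p E ps :
  p \in ps -> E \in path_pairs p -> E \in system_pairs ps.
Proof. by move=> p_ps E_p; apply/flattenP; exists (path_pairs p); rewrite ?map_f. Qed.

(** * Walecki's zigzags *)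

(* Only the terms i - t/2 can leave the interval [0, 2r). *)
Definition zigzag_at (r i t : nat) : nat :=
  if odd t then i + t./2.+1
  else if t./2 <= i then i - t./2 else i + r.*2 - t./2.

Definition zigzag (r i : nat) : seq nat := mkseq (zigzag_at r i) r.*2.

(** The zigzag without its ends [i] and [i + r]: the long arc that remains when the closed cycle
    loses the zigzag's first and last edges. *)
Definition zigzag_mid (r i : nat) : seq nat :=
  mkseq (fun t => zigzag_at r i t.+1) r.*2.-2.

Definition zigzag_tail (r i : nat) : seq nat := rcons (zigzag_mid r i) (i + r).

Lemma zigzagE r i : 0 < r -> zigzag r i = i :: zigzag_tail r i.
Proof.
case: r => // r _; rewrite /zigzag /zigzag_tail /zigzag_mid doubleS.
rewrite mkseqS {1}/mkseq /= (iotaDl 1) -map_comp {1 3}/zigzag_at /= subn0.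
by rewrite odd_double uphalf_double.
Qed.

(** The odd terms are i+1, ..., i+r, the even ones i, i-1, ..., i-r+1 modulo 2r: together 2r
    consecutive residues. *)
Lemma nat_path_zigzag r i : i < r -> nat_path r.*2 (zigzag r i).
Proof.
move=> lt_ir; apply/and3P; split.
- by rewrite -size_eq0 size_mkseq; lia.
- rewrite /zigzag map_inj_in_uniq ?iota_uniq // => s t; rewrite !mem_iota /zigzag_at.
  by case: ifP => s_odd; case: ifP => t_odd; do ?case: ifP => ?; lia.
- apply/allP => x /mapP[t]; rewrite mem_iota => t_lt -> /=; rewrite /zigzag_at.
  by do ?case: ifP => ?; lia.
Qed.

(** Modulo 2r, two consecutive terms of P_i add up to 2i+1 or to 2i, according to whether the step
    starts at an even or an odd position. Hence x+y determines i, and its parity the kind of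
    step. *)
Lemma zigzag_cover r x y : x < y < r.*2 ->
  exists2 i, i < r & (x, y) \in path_pairs (zigzag r i).
Proof.
move=> lt_xyr.
suff [i lt_ir [t lt_tr Et]] : exists2 i, i < r & exists2 t, t.+1 < r.*2 &
    edge (zigzag_at r i t) (zigzag_at r i t.+1) = (x, y).
  exists i => //; rewrite /zigzag; case: (r.*2) lt_tr => // n lt_tn.
  rewrite path_pairs_mkseq -Et; apply/mapP; exists t => //.
  by rewrite mem_iota.
have zo i a : zigzag_at r i a.*2.+1 = i + a.+1.
  by rewrite /zigzag_at /= odd_double /= uphalf_double.
have ze i a : zigzag_at r i a.*2 = if a <= i then i - a else i + r.*2 - a.
  by rewrite /zigzag_at odd_double doubleK.
(* If x+y < 2r, the even term of the step is x = i-a; otherwise it is the wrapped term y = i+2r-a.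
   Solving for a gives the position. *)
have [s_lt|s_ge] := ltnP (x + y) r.*2; case: (boolP (odd (x + y))) => s_odd.
- exists (x + y)./2; first lia.
  exists ((x + y)./2 - x).*2; first lia.
  by rewrite zo ze; rewrite /edge; case: ifP => ?; congr pair; lia.
- exists (x + y)./2; first lia.
  exists ((x + y)./2 - x).-1.*2.+1; first lia.
  by rewrite zo -doubleS ze; rewrite /edge; case: ifP => ?; congr pair; lia.
- exists ((x + y)./2 - r); first lia.
  exists (r + (x + y)./2 - y).*2; first lia.
  by rewrite zo ze; rewrite /edge; case: ifP => ?; congr pair; lia.
- exists ((x + y)./2 - r); first lia.
  exists (r + (x + y)./2 - y).-1.*2.+1; first lia.
  by rewrite zo -doubleS ze; rewrite /edge; case: ifP => ?; congr pair; lia.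
Qed.

Lemma zigzag_tail_head r i : 0 < r -> exists q, zigzag_tail r i = i.+1 :: q.
Proof.
case: r => // r _; have := zigzagE i (ltn0Sn r); rewrite /zigzag doubleS /mkseq /=.
case=> _ <-; rewrite /zigzag_at /= addn1; by eexists.
Qed.

(** Since i < r-1, the last even term i+r+1 stays below 2r; for i = r-1 it would wrap to 0. *)
Lemma zigzag_mid_last r i : i.+1 < r -> exists q, zigzag_mid r i = rcons q (i + r).+1.
Proof.
case: r => [|[|r]] // lt_ir; exists (mkseq (fun t => zigzag_at r.+2 i t.+1) r.*2.+1).
rewrite /zigzag_mid !doubleS [_.-2]/= mkseqS; congr rcons.
by rewrite /zigzag_at /= odd_double doubleK; case: ifP; lia.
Qed.

Lemma size_zigzag_tail r i : 0 < r -> (size (zigzag_tail r i)).+1 = r.*2.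
Proof. by rewrite size_rcons size_mkseq; lia. Qed.

(** Isolates the edge at which the cycles are opened. *)
Lemma path_pairs_zigzag r i : 0 < r ->
  path_pairs (zigzag r i) = (i, i.+1) :: path_pairs (zigzag_tail r i).
Proof.
move=> r_gt0; rewrite zigzagE //; have [q ->] := zigzag_tail_head i r_gt0.
by rewrite /= edge_lt.
Qed.

Lemma path_pairs_cat2 p x y q :
  path_pairs (rcons p x ++ y :: q) =
    path_pairs (rcons p x) ++ edge x y :: path_pairs (y :: q).
Proof. by rewrite cat_rcons path_pairs_cat. Qed.

Lemma mem_path_pairs_cons x p E : E \in path_pairs p -> E \in path_pairs (x :: p).
Proof. by case: p => //= y p Ep; rewrite inE Ep orbT. Qed.

Lemma mem_path_pairs_iota n x : x.+1 < n -> (x, x.+1) \in path_pairs (iota 0 n).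
Proof.
case: n => // n lt_xn; rewrite -[iota 0 _]map_id path_pairs_mkseq.
by apply/mapP; exists x; rewrite ?mem_iota // edge_lt.
Qed.

Lemma nat_path_iota n l : 0 < l <= n -> nat_path n (iota 0 l).
Proof.
case: l => // l le_ln; apply/and3P; split; rewrite ?iota_uniq //.
by apply/allP => x; rewrite mem_iota /=; lia.
Qed.

Lemma nat_path_widen n n' p : n <= n' -> nat_path n p -> nat_path n' p.
Proof.
move=> le_n /and3P[p0 up ap]; rewrite /nat_path p0 up.
by apply/allP => x /(allP ap) /= lt_xn; apply: leq_trans le_n.
Qed.

(** * Explicit decompositions, by parity and by the degree of c *)

(** With n = N+1, the bound [N.+2 %/ 2] is that of the theorem. *)
Definition solution (N k : nat) (ps : seq (seq nat)) : Prop :=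
  [/\ all (nat_path N.+1) ps, perm_eq (system_pairs ps) (target N k)
    & size ps <= N.+2 %/ 2].

(* The lemmas [solution_odd_*] have n = N+1 odd, so no vertex oo; the lemmas
   [solution_even_*] have n even. *)
Lemma solution_odd_few r k : 0 < r -> k <= r -> exists ps, solution r.*2 k ps.
Proof.
move=> r_gt0 le_kr.
(* c = 2r is put before the end i of P_i for each i < k. *)
pose ps := [seq r.*2 :: zigzag r i | i <- iota 0 k]
           ++ [seq zigzag r i | i <- iota k (r - k)].
have sz i : size (zigzag r i) = r.*2.-1.+1 by rewrite size_mkseq prednK // double_gt0.
exists ps; split.
- rewrite all_cat; apply/andP; split; apply/allP => p /mapP[i]; rewrite mem_iota ?add0n => i_lt ->.
    by apply: nat_path_cons => //; apply: nat_path_zigzag; lia.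
  by apply: nat_path_widen (leqnSn _) _; apply: nat_path_zigzag; lia.
- apply: perm_target => [[x y]|].
    rewrite mem_target; last lia.
    rewrite andbC => /andP[/orP[lt_y|/andP[/eqP-> lt_xk]] lt_xy].
      have [|i lt_ir Ei] := @zigzag_cover r x y; first lia.
      rewrite system_pairs_cat mem_cat; have [lt_ik|le_ki] := ltnP i k.
        apply/orP; left; apply: (@mem_system_pairs (r.*2 :: zigzag r i)).
          by apply: (map_f (fun i => _ :: _)); rewrite mem_iota.
        exact: mem_path_pairs_cons.
      apply/orP; right; apply: mem_system_pairs Ei.
      by apply: map_f; rewrite mem_iota; lia.
    apply: (@mem_system_pairs (r.*2 :: zigzag r x)).
      rewrite mem_cat; apply/orP; left.
      by apply: (map_f (fun i => _ :: _)); rewrite mem_iota.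
    by rewrite zigzagE //= edgeC edge_lt ?mem_head //; lia.
  have := size_target r.*2 k.
  rewrite system_pairs_cat size_cat (@size_system_pairs_const _ _ _ r.*2); last first.
    by move=> i /=; rewrite sz; lia.
  rewrite (@size_system_pairs_const _ _ _ r.*2.-1) // !size_iota.
  move=> Esz; nia.
- rewrite size_cat !size_map !size_iota; lia.
Qed.

(** All first ends i < r supply r neighbours of c; the remaining j = k-r are the ends i+r with i <
    j. These j cycles are opened at {i, i+1}, and the path 0, ..., j takes up the deleted edges. *)
Lemma solution_odd_many r k : r < k <= r.*2 -> exists ps, solution r.*2 k ps.
Proof.
move=> lt_rk; have r_gt0 : 0 < r by lia.
pose j := k - r; have lt_j : 0 < j <= r by lia.
pose F i := if i < j then zigzag_tail r i ++ [:: r.*2; i] else r.*2 :: zigzag r i.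
have sz i : size (F i) = r.*2.+1.
  rewrite /F; case: ifP => _; last by rewrite /= size_mkseq.
  by rewrite size_cat /=; have := size_zigzag_tail i r_gt0; lia.
pose ps := iota 0 j.+1 :: [seq F i | i <- iota 0 r].
have F_ps i E : i < r -> E \in path_pairs (F i) -> E \in system_pairs ps.
  move=> lt_ir; apply: mem_system_pairs; rewrite inE; apply/orP; right.
  by apply: map_f; rewrite mem_iota.
have Q_ps E : E \in path_pairs (iota 0 j.+1) -> E \in system_pairs ps.
  by apply: mem_system_pairs; rewrite mem_head.
exists ps; split.
- apply/andP; split; first by apply: nat_path_iota; lia.
  apply/allP => p /mapP[i]; rewrite mem_iota ?add0n => i_lt ->.
  have := nat_path_cons (nat_path_zigzag i_lt) (ltnSn _).
  apply: nat_path_perm; rewrite /F zigzagE //; case: ifP => _ //.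
  by apply/permP => a; rewrite count_cat /=; lia.
- apply: perm_target => [[x y]|].
    rewrite mem_target; last lia.
    rewrite andbC => /andP[/orP[lt_y|/andP[/eqP-> lt_xk]] lt_xy].
      have [|i lt_ir] := @zigzag_cover r x y; first lia.
      have [lt_ij|le_ji] := ltnP i j; last first.
        move=> Ei; apply: (F_ps i) => //; rewrite /F ltnNge le_ji.
        exact: mem_path_pairs_cons.
      rewrite path_pairs_zigzag // inE => /orP[/eqP->|Ei].
        by apply: Q_ps; apply: mem_path_pairs_iota.
      by apply: (F_ps i) => //; rewrite /F lt_ij path_pairs_cat2 mem_cat Ei.
    have [lt_xr|le_rx] := ltnP x r.
      apply: (F_ps x) => //; rewrite /F; case: ifP => _.
        rewrite -(edge_lt lt_xy) path_pairs_cat2 mem_cat /= !inE.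
        by rewrite [edge _ x]edgeC eqxx !orbT.
      by rewrite zigzagE //= edgeC edge_lt ?mem_head.
    apply: (F_ps (x - r)); first lia.
    rewrite /F ifT; last lia.
    by rewrite path_pairs_cat2 mem_cat subnK // edge_lt ?mem_head ?orbT //; lia.
  have := size_target r.*2 k.
  rewrite /ps system_pairs_cons size_cat (@size_system_pairs_const _ _ _ r.*2) //.
  rewrite size_path_pairs /= !size_iota.
  move=> Esz; nia.
- rewrite /= size_map size_iota; lia.
Qed.

(** Each P_i, closed through oo = 2r and opened at {i, i+1}, runs from i+1 to i. The vertex c = 2r+1
    precedes 0 on the additional path, and i+1 on the paths with i < k-1. *)
Lemma solution_even_few r k : 0 < r -> 0 < k <= r.+1 ->
  exists ps, solution r.*2.+1 k ps.
Proof.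
move=> r_gt0 lt_k.
pose F i := zigzag_tail r i ++ [:: r.*2; i].
have sz i : size (F i) = r.*2.+1.
  by rewrite size_cat /=; have := size_zigzag_tail i r_gt0; lia.
pose ps := (r.*2.+1 :: iota 0 r.+1) :: [seq r.*2.+1 :: F i | i <- iota 0 k.-1]
           ++ [seq F i | i <- iota k.-1 (r - k.-1)].
have cF_ps i E : i < k.-1 -> E \in path_pairs (r.*2.+1 :: F i) -> E \in system_pairs ps.
  move=> lt_ik; apply: mem_system_pairs; rewrite inE mem_cat; apply/or3P/Or32.
  by apply: (map_f (fun i => _ :: _)); rewrite mem_iota.
have F_ps i E : i < r -> E \in path_pairs (F i) -> E \in system_pairs ps.
  move=> lt_ir Ei; have [lt_ik|le_ki] := ltnP i k.-1.
    by apply: (cF_ps i) => //; apply: mem_path_pairs_cons.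
  apply: mem_system_pairs Ei; rewrite inE mem_cat; apply/or3P/Or33.
  by apply: map_f; rewrite mem_iota; lia.
have Q_ps E : E \in path_pairs (r.*2.+1 :: iota 0 r.+1) -> E \in system_pairs ps.
  by apply: mem_system_pairs; rewrite mem_head.
have path_F i : i < r -> nat_path r.*2.+1 (F i).
  move=> lt_ir; have := nat_path_cons (nat_path_zigzag lt_ir) (ltnSn _).
  apply: nat_path_perm; rewrite /F zigzagE //.
  by apply/permP => a; rewrite count_cat /=; lia.
exists ps; split.
- apply/andP; split.
    by apply: nat_path_cons (ltnSn _); apply: nat_path_iota; lia.
  rewrite -/(all _ _) all_cat.
  apply/andP; split; apply/allP => p /mapP[i]; rewrite mem_iota ?add0n => i_lt ->.
    by apply: nat_path_cons (ltnSn _); apply: path_F; lia.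
  by apply: nat_path_widen (leqnSn _) _; apply: path_F; lia.
- apply: perm_target => [[x y]|].
    rewrite mem_target; last lia.
    (* The larger end is oo, a vertex of the zigzags, or c. On cycle i, oo is joined to i and
       i+r. *)
    rewrite andbC ltnS [y <= _]leq_eqVlt => /andP[/orP[/orP[/eqP->|lt_y]|/andP[/eqP-> lt_xk]] lt_xy].
        have [lt_xr|le_rx] := ltnP x r.
          apply: (F_ps x) => //; rewrite /F path_pairs_cat2 mem_cat /= !inE.
          by rewrite -(edge_lt lt_xy) [edge _ x]edgeC eqxx !orbT.
        apply: (F_ps (x - r)); first lia.
        by rewrite /F path_pairs_cat2 mem_cat subnK // edge_lt // mem_head orbT.
      have [|i lt_ir] := @zigzag_cover r x y; first lia.
      rewrite path_pairs_zigzag // inE => /orP[/eqP->|Ei].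
        by apply: Q_ps; apply: mem_path_pairs_cons; apply: mem_path_pairs_iota.
      by apply: (F_ps i) => //; rewrite /F path_pairs_cat2 mem_cat Ei.
    case: x lt_xk lt_xy => [|i] lt_ik lt_i.
      by apply: Q_ps; rewrite /= edgeC edge_lt // mem_head.
    apply: (cF_ps i); first lia.
    have [q Eq] := zigzag_tail_head i r_gt0.
    by rewrite /F Eq /= edgeC edge_lt // mem_head.
  have := size_target r.*2.+1 k.
  rewrite /ps system_pairs_cons system_pairs_cat !size_cat (@size_system_pairs_const _ _ _ r.*2.+1); last first.
    by move=> i /=; rewrite sz.
  rewrite (@size_system_pairs_const _ _ _ r.*2) //.
  rewrite size_path_pairs /= !size_iota.
  move=> Esz; nia.
- rewrite /= size_cat !size_map !size_iota; lia.
Qed.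

Lemma solution_even_many r k : r.+1 < k <= r.*2 -> exists ps, solution r.*2.+1 k ps.
Proof.
move=> lt_k; have r_gt0 : 0 < r by lia.
(* c goes to 0 (on the additional path), to r and r+1 (cycle 0), to i and i+r+1
   (cycles 0 < i < d) and to i (cycles d <= i < r): all of 0, ..., r+d. *)
pose d := k - r.+1; have lt_d : 0 < d < r by lia.
(* The short arc is i, oo, i+r, entered from c at [u i] and left at [v i]. It is reversed for i = 0,
   because c meets 0 on the additional path and still needs r. *)
pose u i := if i == 0 then r else i; pose v i := if i == 0 then 0 else i + r.
pose F i := if i < d then zigzag_mid r i ++ [:: r.*2.+1; u i; r.*2; v i]
            else zigzag_tail r i ++ [:: r.*2; i; r.*2.+1].
have sz i : size (F i) = r.*2.+2.
  rewrite /F; case: ifP => _; rewrite size_cat ?size_rcons size_mkseq /=; lia.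
pose ps := (r.*2.+1 :: iota 0 k) :: [seq F i | i <- iota 0 r].
have F_ps i E : i < r -> E \in path_pairs (F i) -> E \in system_pairs ps.
  move=> lt_ir; apply: mem_system_pairs; rewrite inE; apply/orP; right.
  by apply: map_f; rewrite mem_iota.
have Q_ps E : E \in path_pairs (r.*2.+1 :: iota 0 k) -> E \in system_pairs ps.
  by apply: mem_system_pairs; rewrite mem_head.
have pairs_lt i : i < d -> exists2 q, zigzag_mid r i = rcons q (i + r).+1 &
    path_pairs (F i) = path_pairs (zigzag_mid r i) ++ [:: edge (i + r).+1 r.*2.+1; edge r.*2.+1 (u i);
      edge (u i) r.*2; edge r.*2 (v i)].
  move=> lt_id; have [|q Eq] := @zigzag_mid_last r i; first lia.
  by exists q => //; rewrite /F lt_id Eq path_pairs_cat2.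
have pairs_ge i : d <= i -> path_pairs (F i) =
    path_pairs (zigzag_tail r i) ++ [:: edge (i + r) r.*2; edge r.*2 i; edge i r.*2.+1].
  by move=> le_di; rewrite /F ltnNge le_di /= path_pairs_cat2.
exists ps; split.
- apply/andP; split.
    by apply: nat_path_cons (ltnSn _); apply: nat_path_iota; lia.
  apply/allP => p /mapP[i]; rewrite mem_iota ?add0n => i_lt ->.
  have := nat_path_cons (nat_path_cons (nat_path_zigzag i_lt) (ltnSn _)) (ltnSn _).
  apply: nat_path_perm; rewrite /F zigzagE // /zigzag_tail /u /v.
  case: ifP => _; first case: eqP => [->|_];
    by apply/permP => a; rewrite /= -!cats1 !count_cat /= ?add0n; lia.
- apply: perm_target => [[x y]|].
    rewrite mem_target; last lia.
    rewrite andbC ltnS [y <= _]leq_eqVlt => /andP[/orP[/orP[/eqP->|lt_y]|/andP[/eqP-> lt_xk]] lt_xy].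
        pose i := if x < r then x else x - r.
        have lt_ir : i < r by rewrite /i; case: ifP; lia.
        apply: (F_ps i) => //; rewrite -(edge_lt lt_xy).
        have [lt_id|le_di] := ltnP i d.
          have [q _ ->] := pairs_lt i lt_id; rewrite mem_cat !inE [edge _ (v i)]edgeC.
          suff [->|->] : x = u i \/ x = v i by rewrite eqxx !orbT.
          by rewrite /u /v /i; case: ltnP => ?; case: eqP; lia.
        rewrite pairs_ge // mem_cat !inE [edge _ i]edgeC.
        suff [->|->] : x = i \/ x = i + r by rewrite eqxx !orbT.
        by rewrite /i; case: ltnP => ?; lia.
      have [|i lt_ir] := @zigzag_cover r x y; first lia.
      rewrite path_pairs_zigzag // inE => /orP[/eqP->|Ei].
        by apply: Q_ps; apply: mem_path_pairs_cons; apply: mem_path_pairs_iota; lia.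
      have [lt_id|le_di] := ltnP i d; last first.
        by apply: (F_ps i) => //; rewrite pairs_ge // mem_cat Ei.
      have [q Eq Fi] := pairs_lt i lt_id.
      (* For i < d the last edge {i+r, i+r+1} of P_i is deleted too and lies on the additional
         path. *)
      move: Ei; rewrite /zigzag_tail Eq path_pairs_rcons2 mem_rcons inE => /orP[/eqP->|Ei].
        rewrite edgeC edge_lt //; apply: Q_ps; apply: mem_path_pairs_cons.
        by apply: mem_path_pairs_iota; lia.
      by apply: (F_ps i) => //; rewrite Fi mem_cat Eq Ei.
    rewrite -(edge_lt lt_xy).
    have [->|x_neq0] := eqVneq x 0.
      by apply: Q_ps; case: (k) lt_xk => //= k' _; rewrite edgeC mem_head.
    have [lt_xd|le_dx] := ltnP x d.
      apply: (F_ps x); first lia.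
      have [q _ ->] := pairs_lt x lt_xd; rewrite mem_cat !inE [edge _ (u x)]edgeC.
      by rewrite /u (negPf x_neq0) eqxx !orbT.
    have [lt_xr|le_rx] := ltnP x r.
      by apply: (F_ps x) => //; rewrite pairs_ge // mem_cat !inE eqxx !orbT.
    have [->|x_neqr] := eqVneq x r.
      apply: (F_ps 0) => //; have [|q _ ->] := pairs_lt 0; first lia.
      by rewrite mem_cat !inE [edge _ (u 0)]edgeC /u !eqxx !orbT.
    apply: (F_ps (x - r.+1)); first lia.
    have [|q _ ->] := pairs_lt (x - r.+1); first lia.
    rewrite mem_cat !inE; have ->: (x - r.+1 + r).+1 = x by lia.
    by rewrite eqxx !orbT.
  have := size_target r.*2.+1 k.
  rewrite /ps system_pairs_cons size_cat (@size_system_pairs_const _ _ _ r.*2.+1) //.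
  rewrite size_path_pairs /= !size_iota.
  move=> Esz; nia.
- rewrite /= size_map size_iota; lia.
Qed.

(** The graph is complete on 2(r+1) vertices, and c serves as an ordinary vertex of the zigzags. *)
Lemma solution_even_full r : exists ps, solution r.*2.+1 r.*2.+1 ps.
Proof.
pose ps := [seq zigzag r.+1 i | i <- iota 0 r.+1].
exists ps; split.
- apply/allP => p /mapP[i]; rewrite mem_iota ?add0n => i_lt ->.
  by rewrite -doubleS; apply: nat_path_zigzag.
- apply: perm_target => [[x y]|].
    rewrite mem_target // => lt_xy.
    have [|i lt_ir Ei] := @zigzag_cover r.+1 x y; first lia.
    by apply: mem_system_pairs Ei; apply: map_f; rewrite mem_iota.
  have := size_target r.*2.+1 r.*2.+1.
  rewrite (@size_system_pairs_const _ _ _ r.*2.+1) ?size_iota; last first.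
    by move=> i; rewrite size_mkseq.
  move=> Esz; nia.
- rewrite size_map size_iota; lia.
Qed.

Lemma solution_exists N k : 0 < k <= N -> exists ps, solution N k ps.
Proof.
move=> k_bd; rewrite -(odd_double_half N); set r := N./2.
have EN := odd_double_half N; rewrite -/r in EN.
case: (odd N) EN => EN; rewrite ?add0n ?add1n in EN *.
  (* This covers r = 0, where k = 1 is the only value; afterwards r > 0. *)
  have [->|k_neq] := eqVneq k r.*2.+1; first exact: solution_even_full.
  have [le_kr|lt_rk] := leqP k r.+1; first by apply: solution_even_few; lia.
  by apply: solution_even_many; lia.
have [le_kr|lt_rk] := leqP k r; first by apply: solution_odd_few; lia.
by apply: solution_odd_many; lia.
Qed.

(** * Transfer to a graph on a finite type *)

(** An element of two of the lists would be repeated in the concatenation. This turns the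
    permutation of pairs into the exactly-one condition. *)
Lemma count_mem_flatten_uniq (U : eqType) (E : U) (ss : seq (seq U)) :
  uniq (flatten ss) -> E \in flatten ss -> count (fun s => E \in s) ss = 1.
Proof.
elim: ss => //= s ss IHss; rewrite cat_uniq mem_cat => /and3P[_ /hasPn disj uss].
have [Es _|_ /= Ess] := boolP (E \in s); last by rewrite IHss.
apply/eqP; rewrite eqSS -leqn0 leqNgt -has_count; apply/hasPn => s' s'_ss.
by apply: contraTN Es => Es'; apply: disj; apply/flattenP; exists s'.
Qed.

Lemma path_edges_map (T : finType) (f : nat -> T) p :
  path_edges (map f p) = [seq [set f E.1; f E.2] | E <- path_pairs p].
Proof.
case: p => //= x q; elim: q x => //= y q IHq x; rewrite IHq; congr cons.
by rewrite /edge; case: (leqP x y) => _ //; rewrite setUC.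
Qed.

(** The labelling [f] carries pairs of [target] bijectively to edges of [e]; adjacency along the
    paths and exact covering both follow. *)
Lemma path_decomposition_map (T : finType) (e : rel T) (f : nat -> T) N k ps :
    symmetric e -> irreflexive e -> {in gtn N.+1 &, injective f} ->
    (forall a, exists2 x, x < N.+1 & f x = a) ->
    (forall x y, x < y < N.+1 -> e (f x) (f y) = ((x, y) \in target N k)) ->
    k <= N -> solution N k ps ->
  path_decomposition e [seq map f p | p <- ps].
Proof.
move=> symE irrE injf surf eE le_kN [ps_ok ps_pairs _].
have lt_target x y : (x, y) \in target N k -> x < y < N.+1.
  by rewrite mem_target //; lia.
have sub p : p \in ps -> {subset path_pairs p <= target N k}.
  move=> p_ps E Ep; rewrite -(perm_mem ps_pairs).
  exact: mem_system_pairs Ep.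
have e_edge x y : edge x y \in target N k -> e (f x) (f y).
  rewrite /edge; case: (leqP x y) => _ xy; last rewrite symE.
    by rewrite eE ?xy // lt_target.
  by rewrite eE ?xy // lt_target.
have injg : {in target N k &, injective (fun E => [set f E.1; f E.2])}.
  move=> [x y] [x' y'] /lt_target /andP[lt_xy lt_y] /lt_target /andP[lt_xy' lt_y'].
  move=> /= /setP eq_g.
  have lt_x := ltn_trans lt_xy lt_y; have lt_x' := ltn_trans lt_xy' lt_y'.
  have inj_eq z z' : z < N.+1 -> z' < N.+1 -> (f z == f z') = (z == z').
    by move=> lt_z lt_z'; apply: inj_in_eq injf _ _ lt_z lt_z'.
  have := eq_g (f x); have := eq_g (f y); have := eq_g (f x').
  by rewrite !inE !inj_eq // => ? ? ?; congr pair; lia.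
split.
  apply/allP => _ /mapP[p p_ps ->]; have /and3P[p0 up /allP lt_p] := allP ps_ok p p_ps.
  have {up} : uniq (map f p).
    by rewrite map_inj_in_uniq // => x y /lt_p ? /lt_p ?; apply: injf.
  (* Consecutive vertices are adjacent since every pair of the path lies in [target]. *)
  have := sub p p_ps; case: p p0 {p_ps lt_p} => //= x q _ sub_xq ->; rewrite andbT.
  elim: q x sub_xq => //= y q IHq x sub_q; rewrite e_edge ?IHq //.
    by move=> E Eq; apply: sub_q; rewrite inE Eq orbT.
  by apply: sub_q; rewrite mem_head.
move=> _ /imsetP[[a b] /= + ->]; rewrite inE /=.
have [[x lt_x <-] [y lt_y <-]] := (surf a, surf b).
wlog le_xy : x y lt_x lt_y / x <= y.
  move=> hwlog exy; have [?|?] := leqP x y; first exact: hwlog.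
  by rewrite setUC; apply: hwlog => //; [apply: ltnW | rewrite symE].
move=> exy; have lt_xy : x < y.
  by rewrite ltn_neqAle le_xy andbT; apply: contraTneq exy => ->; rewrite irrE.
have xy_target : (x, y) \in target N k by rewrite -eE // lt_xy.
rewrite count_map -(@count_mem_flatten_uniq _ (x, y) (map path_pairs ps)).
- rewrite count_map; apply: eq_in_count => p p_ps /=; rewrite path_edges_map.
  apply/mapP/idP => [[E Ep]|xy_p]; last by exists (x, y).
  by move=> /(injg (x, y) E xy_target (sub p p_ps E Ep)) ->.
- by rewrite (perm_uniq ps_pairs) uniq_target.
- by rewrite (perm_mem ps_pairs).
Qed.

(** * Stars and the labelling of the vertices *)

(** Sending a leaf x to {c, x} is onto the edges, and injective because irreflexivity keeps x away
    from c. *)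
Lemma card_star_leaves (T : finType) (m : nat) (s : rel T) (c : T) :
    simple_graph s -> (forall x y, s x y -> x = c \/ y = c) ->
  #|edges s| = #|[set x | s c x]|.
Proof.
move=> [symS irrS] s_c.
rewrite -(@card_in_imset _ _ (fun x => [set c; x]) [set x | s c x]); last first.
  move=> x y; rewrite !inE => cx cy /setP/(_ x); rewrite !inE eqxx orbT.
  by case: eqP cx => [->|_ _ /esym/eqP]; rewrite ?irrS.
apply: eq_card => E; apply/imsetP/imsetP => [[[a b] + ->]|[x + ->]]; rewrite inE /=.
  move=> sab; have [Ea|Eb] := s_c _ _ sab.
    by exists b; rewrite -?Ea ?inE.
  by exists a; rewrite -?Eb ?inE 1?symS // setUC.
by move=> cx; exists (c, x); rewrite ?inE.
Qed.

Theorem theorem1 (n m : nat) (S : rel 'I_n) :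
  2 <= n -> m <= n - 2 ->
  subrel S (complete_graph 'I_n) -> star m S ->
  exists ps : seq (seq 'I_n),
    path_decomposition (delete_edges (complete_graph 'I_n) S) ps /\
    size ps <= (n + 1) %/ 2.
Proof.
move=> n_ge2 le_m _ [gS cardS [c S_c]]; have [symS irrS] := gS.
(* The labelling lists first the vertices still joined to c, then the leaves of the star, and c
   last, with label n-1. *)
pose B := [set x | S c x]; pose A := [set x | (x != c) && ~~ S c x].
have cardB : #|B| = m by rewrite -(card_star_leaves m gS S_c).
pose l := enum A ++ enum B ++ [:: c].
have memA x : (x \in enum A) = (x != c) && ~~ S c x by rewrite mem_enum inE.
have memB x : (x \in enum B) = S c x by rewrite mem_enum inE.
have ul : uniq l.
  rewrite !cat_uniq !enum_uniq /= !orbF memB irrS andbT /= andbT.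
  by apply/hasPn => x; rewrite mem_cat memB mem_seq1 memA negb_and !negbK orbC.
have ml x : x \in l.
  by rewrite !mem_cat memA memB mem_seq1; case: eqP; case: (S c x).
have sz_l : size l = n.
  rewrite -[RHS](card_ord n) cardE; apply: perm_size.
  by apply: uniq_perm => // [|x]; rewrite ?enum_uniq // mem_enum ml.
have sz_AB : size (enum A ++ enum B) = n.-1.
  by move: sz_l; rewrite /l catA size_cat addn1 => /(congr1 predn).
have EA : #|A| + m = n.-1 by rewrite -cardB -sz_AB size_cat -!cardE.
(* Here k = n-1-m, which is positive because m <= n-2. *)
have [ps ps_sol] : exists ps, solution n.-1 #|A| ps by apply: solution_exists; lia.
have n1 : n.-1.+1 = n by lia.
have ltn_n z : (z < n.-1.+1) = (z < n) by rewrite n1.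
exists (map (map (nth c l)) ps); split; last first.
  by case: ps_sol => _ _; rewrite n1 size_map addn1.
apply: path_decomposition_map ps_sol.
- by move=> x y; rewrite /delete_edges /complete_graph /= eq_sym symS.
- by move=> x; rewrite /delete_edges /complete_graph /= eqxx.
- move=> x y; rewrite !inE !ltn_n => lt_x lt_y /eqP.
  by rewrite nth_uniq ?sz_l // => /eqP.
- by move=> a; exists (index a l); rewrite ?nth_index // ltn_n -[X in _ < X]sz_l index_mem.
- move=> x y; rewrite ltn_n => lt_xy; rewrite mem_target; last lia.
  have lt_x : x < n by lia.
  rewrite /delete_edges /complete_graph /= nth_uniq ?sz_l //; last lia.
  have nthAB z : z < n.-1 -> nth c l z != c.
    move=> lt_z; rewrite /l catA nth_cat sz_AB lt_z.
    apply: contraTneq (mem_nth c (_ : z < size (enum A ++ enum B))) => [->|].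
      by rewrite mem_cat memA memB eqxx irrS.
    by rewrite sz_AB.
  have [lt_y|le_y] := ltnP y n.-1.
    (* Every deleted edge meets c, so pairs of smaller labels stay adjacent. *)
    have /negPf-> : ~~ S (nth c l x) (nth c l y); last by lia.
    apply/negP => /S_c [] /eqP; apply/negP; apply: nthAB; lia.
  have -> : nth c l y = c.
    by rewrite /l catA nth_cat sz_AB ltnNge le_y (_ : y - n.-1 = 0) //; lia.
  have lt_x1 : x < n.-1 by lia.
  have -> : ~~ S (nth c l x) c = (x < #|A|).
    rewrite symS /l nth_cat -cardE; case: ltnP => [lt_xA|le_Ax].
      by have := mem_nth c (_ : x < size (enum A)); rewrite -cardE memA => /(_ lt_xA) /andP[].
    rewrite nth_cat -cardE cardB ifT; last lia.
    apply/negbF; rewrite -memB; apply: mem_nth; rewrite -cardE cardB; lia.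
  by have [-> -> ->] : [/\ x != y, x < y & y == n.-1] by split; lia.
- by rewrite -EA leq_addr.
Qed.
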